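(* Let $f$ be holomorphic near the origin, let $R\in(0,\infty]$ be the radius of convergence of its Taylor series at $0$, and let $\alpha\neq 0$ be a complex number. Then, for $|x^\alpha|<R$, $$\int\frac{1}{x}f(x^\alpha)\,dx=f(0)\ln x+\frac{f(x^\alpha)-f(0)}{\alpha}-\frac{x^\alpha}{\alpha}\,[\epsilon]\, f'\left(\left.\begin{array}{c}1+\epsilon\\ 2+\epsilon\end{array}\right| x^\alpha\right)+c ,$$ where $c$ is an arbitrary constant; that is, the right-hand side (without $c$) is an antiderivative of $\frac1x f(x^\alpha)$.
   Context: The Pochhammer symbol is $(a)_k=a(a+1)\cdots(a+k-1)$, $(a)_0=1$. For $g$ holomorphic near $0$ and complex numbers $a,c$ with $1-c\notin\mathbb{N}=\{1,2,3,\dots\}$, the hypergeometrization of $g$ is $$g\left(\left.\begin{array}{c}a\\ c\end{array}\right| x\right):=\sum_{k=0}^{\infty}\frac{g^{(k)}(0)}{k!}\frac{(a)_k}{(c)_k}x^k ;$$ in the claim it is applied to $g=f'$, the derivative of $f$. For a function $h(\epsilon)$ holomorphic near $\epsilon=0$, $[\epsilon^k]h(\epsilon)=\frac{h^{(k)}(0)}{k!}$ denotes the $k$-th Taylor coefficient in $\epsilon$ at $0$, and $[\epsilon]=[\epsilon^1]$, so $[\epsilon]h(\epsilon)=h'(0)$. An identity $\int g(x)\,dx=G(x)+c$ means that $G'(x)=g(x)$. Here $x$ ranges over any open connected set $U\subset\mathbb{C}\setminus\{0\}$ (or open interval of $(0,\infty)$) on which a branch of $\ln x$ is fixed, $x^s=\exp(s\ln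 x)$ with this branch, and $|x^\alpha|<R$ on $U$. On such a set $f(x^\alpha)$ denotes the sum of the Taylor series of $f$ at $x^\alpha$. *)

(* Defs.v *)
From Stdlib Require Import Reals Factorial.
From Coquelicot Require Import Coquelicot.

Local Open Scope C_scope.

(** Stdlib reals and the complex numbers [C] of Coquelicot.
    Coquelicot equips [C] with several module structures.  Complex derivatives
    are [is_derive] over [C_AbsRing] into [C_NormedModule]; derivatives of
    functions [R -> C] are [is_derive] over [R_AbsRing] into [C_R_NormedModule]. *)

Definition is_C_derive (f : C -> C) (z l : C) : Prop :=
  @is_derive C_AbsRing C_NormedModule f z l.

Definition is_RC_derive (f : R -> C) (x : R) (l : C) : Prop :=
  @is_derive R_AbsRing C_R_NormedModule f x l.

Definition holomorphic_near (f : C -> C) (z0 : C) : Prop :=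
  @locally C_UniformSpace z0 (fun z => exists l : C, is_C_derive f z l).

Fixpoint C_derive_n (f : C -> C) (n : nat) (z : C) : C :=
  match n with
  | O => f z
  | S n' => C_derive (C_derive_n f n') z
  end.

(** [coef k h] is the k-th Taylor coefficient at 0 of [h]. *)
Definition coef (k : nat) (h : C -> C) : C :=
  C_derive_n h k 0 / INR (fact k).

Definition is_Cseries (a : nat -> C) (l : C) : Prop :=
  @is_series C_AbsRing C_NormedModule a l.

(** Coquelicot's total sum [Series] exists only for real series, so it is
    taken componentwise; the value is meaningful only if the series converges. *)
Definition CSeries (a : nat -> C) : C :=
  (Series (fun k => Re (a k)), Series (fun k => Im (a k))).

Definition taylor_sum (f : C -> C) (z : C) : C :=
  CSeries (fun k => coef k f * z ^ k).

(** Supremum in [[0, +oo]] of the moduli of the points of convergence of the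
    power series with coefficients [a]. *)
Definition convergence_radius (a : nat -> C) : Rbar :=
  Lub_Rbar (fun r : R =>
    exists z l : C, Cmod z = r /\ is_Cseries (fun k => a k * z ^ k) l).

Fixpoint pochhammer (a : C) (k : nat) : C :=
  match k with
  | O => 1
  | S k' => pochhammer a k' * (a + INR k')
  end.

Definition hyper_term (g : C -> C) (a c x : C) (k : nat) : C :=
  coef k g * (pochhammer a k / pochhammer c k) * x ^ k.

(** To be used only when [c] is not one of 0, -1, -2, ...: otherwise the
    denominators vanish and division by zero takes an arbitrary value. *)
Definition hypergeometrization (g : C -> C) (a c x : C) : C :=
  CSeries (hyper_term g a c x).

Definition Cexp (z : C) : C :=
  (exp (Re z) * cos (Im z), exp (Re z) * sin (Im z))%R.

Definition C_open (U : C -> Prop) : Prop := @open C_UniformSpace U.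

Definition C_connected (U : C -> Prop) : Prop :=
  forall V W : C -> Prop,
    C_open V -> C_open W ->
    (forall z, U z -> V z \/ W z) ->
    (exists z, U z /\ V z) -> (exists z, U z /\ W z) ->
    exists z, U z /\ V z /\ W z.

(** The next two predicates are meant for open sets, where continuity on the
    set is continuity at each of its points. *)
Definition ln_branch (U : C -> Prop) (L : C -> C) : Prop :=
  forall z, U z -> @continuous C_UniformSpace C_UniformSpace L z /\ Cexp (L z) = z.

Definition ln_branch_R (I : R -> Prop) (L : R -> C) : Prop :=
  forall x, I x -> @continuous R_UniformSpace C_UniformSpace L x /\ Cexp (L x) = RtoC x.

(** The power x^s for the branch [L] of the logarithm; the domain [T] is [C] or [R]. *)
Definition power {T : Type} (L : T -> C) (s : C) (x : T) : C := Cexp (s * L x).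

(* Main.v *)
Require Import Defs.
From Stdlib Require Import Reals Lra Factorial.
From Coquelicot Require Import Coquelicot.

Local Open Scope C_scope.

(** Write [a_n] for the Taylor coefficients of [f], put [w = x^alpha], and let [F] be
    the sum of the Taylor series.  Since [(1+eps)_k / (2+eps)_k] telescopes to
    [(1+eps) / (k+1+eps)], the hypergeometrization of [f'] is
      [sum_k (k+1) a_(k+1) (1+eps) / (k+1+eps) w^k],
    and the [eps]-derivative of its factor [(1+eps) / (k+1+eps)] at [0] is
    [k / (k+1)^2].  Hence, by termwise differentiation in [eps],
      [F(w) - a_0 - w [eps] f'(1+eps; 2+eps | w) = sum_(n>=1) a_n w^n / n =: S(w)]
    ([log_primitive_eq]), and the claimed antiderivative is [a_0 ln x + S(x^alpha) / alpha].
    As [w S'(w) = F(w) - a_0] and [x dw/dx = alpha w], its derivative is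
    [a_0 / x + (F(w) - a_0) / x = F(w) / x].

    Two analytic facts carry this.  Both termwise differentiations, in [eps] and in [w],
    are instances of [is_C_derive_CSeries]: a series of functions may be differentiated
    termwise when the first-order Taylor remainders of its terms are bounded by
    [M_k |h|^2] with [sum M_k] finite.  The derivative [1/x] of a continuous branch of the
    logarithm is [log_branch_derives_along].

    The complex and the real variable are treated at once by [derives_along], which
    differentiates with respect to a map [phi] into the complex numbers: the identity in
    the first case, the inclusion of the reals in the second. *)

(** * Derivatives with respect to a complex-valued map *)

Lemma locally_Cmod (z : C) (P : C -> Prop) :
  @locally C_UniformSpace z P <->
  exists d : posreal, forall y, (Cmod (y - z) < d)%R -> P y.
Proof.
  rewrite locally_C. split; intros [d Hd]; exists d; intros y Hy; apply Hd; exact Hy.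
Qed.

Lemma filterlim_Cmod {T : Type} (F : (T -> Prop) -> Prop) {FF : Filter F}
    (f : T -> C) (l : C) :
  filterlim f F (@locally C_UniformSpace l) <->
  forall eps : posreal, F (fun y => (Cmod (f y - l) < eps)%R).
Proof.
  split.
  - intros H eps. apply (H (fun v => (Cmod (v - l) < eps)%R)).
    apply locally_Cmod. now exists eps.
  - intros H P HP. apply locally_Cmod in HP. destruct HP as [d Hd].
    unfold filtermap. generalize (H d). apply filter_imp. intros y; apply Hd.
Qed.

(** The value [l] plays the role of [df / dphi] at [x], for the limit taken along [F].
    Multiplying out the difference quotient allows [phi y = phi x]. *)
Definition derives_along {T : Type} (F : (T -> Prop) -> Prop) (phi f : T -> C)
    (x : T) (l : C) : Prop :=
  forall eps : posreal, F (fun y =>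
    (Cmod (f y - f x - (phi y - phi x) * l) <= eps * Cmod (phi y - phi x))%R).

Lemma is_C_derive_along (f : C -> C) (z l : C) :
  is_C_derive f z l <-> derives_along (@locally C_UniformSpace z) (fun y => y) f z l.
Proof.
  unfold is_C_derive, is_derive, derives_along. split.
  - intros [_ H] eps. apply locally_C.
    exact (H z (fun P HP => HP) eps).
  - intros H. split. { apply is_linear_scal_l. }
    intros x Hx eps.
    rewrite <- (@is_filter_lim_locally_unique C_AbsRing (AbsRing_NormedModule C_AbsRing) z x Hx).
    apply locally_C. exact (H eps).
Qed.

(** As a real normed module, [C] carries the norm of the product [R * R], which has the
    absolute values of the components under the square root. *)
Lemma norm_C_R (z : C) : @norm R_AbsRing C_R_NormedModule z = Cmod z.
Proof.
  change (sqrt (Rabs (fst z) ^ 2 + Rabs (snd z) ^ 2) = sqrt (fst z ^ 2 + snd z ^ 2)).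
  now rewrite !pow2_abs.
Qed.

Lemma is_RC_derive_along (f : R -> C) (x : R) (l : C) :
  is_RC_derive f x l <-> derives_along (locally x) RtoC f x l.
Proof.
  assert (E : forall (y eps : R),
    ((@norm R_AbsRing C_R_NormedModule
       (minus (minus (f y) (f x)) (scal (minus y x) l))) <= eps * norm (minus y x))%R
    <-> (Cmod (f y - f x - (RtoC y - RtoC x) * l) <= eps * Cmod (RtoC y - RtoC x))%R).
  { intros y eps. rewrite norm_C_R, scal_R_Cmult.
    replace (RtoC (minus y x)) with (RtoC y - RtoC x) by (rewrite <- RtoC_minus; reflexivity).
    replace (norm (minus y x)) with (Cmod (RtoC y - RtoC x))
      by (rewrite <- RtoC_minus, Cmod_R; reflexivity).
    reflexivity. }
  unfold is_RC_derive, is_derive, derives_along. split.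
  - intros [_ H] eps. generalize (H x (fun P HP => HP) eps).
    apply filter_imp. intros y; apply E.
  - intros H. split. { apply is_linear_scal_l. }
    intros x' Hx eps.
    rewrite <- (is_filter_lim_locally_unique x x' Hx).
    generalize (H eps). apply filter_imp. intros y; apply E.
Qed.

Section Along.
Context {T : Type} (F : (T -> Prop) -> Prop) {FF : Filter F} (phi : T -> C) (x : T).

Lemma derives_along_ext f g l :
  F (fun y => f y = g y) -> f x = g x ->
  derives_along F phi f x l -> derives_along F phi g x l.
Proof.
  intros Hfg Hx Hf eps. generalize (filter_and _ _ Hfg (Hf eps)).
  apply filter_imp. intros y [<- H]. now rewrite <- Hx.
Qed.

Lemma derives_along_plus f g l m :
  derives_along F phi f x l -> derives_along F phi g x m ->
  derives_along F phi (fun y => f y + g y) x (l + m).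
Proof.
  intros Hf Hg eps.
  generalize (filter_and _ _ (Hf (pos_div_2 eps)) (Hg (pos_div_2 eps))).
  apply filter_imp. simpl. intros y [H1 H2].
  replace (f y + g y - (f x + g x) - (phi y - phi x) * (l + m))
    with ((f y - f x - (phi y - phi x) * l) + (g y - g x - (phi y - phi x) * m)) by ring.
  eapply Rle_trans; [apply Cmod_triangle | lra].
Qed.

Lemma derives_along_scal c f l :
  derives_along F phi f x l ->
  derives_along F phi (fun y => c * f y) x (c * l).
Proof.
  intros Hf eps.
  assert (Hc : (0 < Cmod c + 1)%R) by (generalize (Cmod_ge_0 c); lra).
  generalize (Hf (mkposreal _ (Rdiv_lt_0_compat _ _ (cond_pos eps) Hc))).
  apply filter_imp. simpl. intros y H.
  replace (c * f y - c * f x - (phi y - phi x) * (c * l))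
    with (c * (f y - f x - (phi y - phi x) * l)) by ring.
  rewrite Cmod_mult.
  apply Rle_trans with ((Cmod c + 1) * (eps / (Cmod c + 1) * Cmod (phi y - phi x)))%R.
  - apply Rmult_le_compat; try apply Cmod_ge_0; lra.
  - right. field. lra.
Qed.

Lemma derives_along_continuous f l :
  filterlim phi F (@locally C_UniformSpace (phi x)) ->
  derives_along F phi f x l -> filterlim f F (@locally C_UniformSpace (f x)).
Proof.
  intros Hphi Hf. apply (filterlim_Cmod F). intros eps.
  assert (Hl : (0 < Cmod l + 1)%R) by (generalize (Cmod_ge_0 l); lra).
  generalize (filter_and _ _ (Hf (mkposreal 1 Rlt_0_1))
    (proj1 (filterlim_Cmod F phi (phi x)) Hphi
       (mkposreal _ (Rdiv_lt_0_compat _ _ (cond_pos eps) Hl)))).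
  apply filter_imp. simpl. intros y [H1 H2].
  replace (f y - f x) with ((f y - f x - (phi y - phi x) * l) + (phi y - phi x) * l) by ring.
  eapply Rle_lt_trans; [apply Cmod_triangle|]. rewrite Cmod_mult.
  apply Rle_lt_trans with ((Cmod l + 1) * Cmod (phi y - phi x))%R; [lra|].
  apply Rlt_le_trans with ((Cmod l + 1) * (eps / (Cmod l + 1)))%R.
  - apply Rmult_lt_compat_l; assumption.
  - right. field. lra.
Qed.

(** The error in [G] is at most [e1 |f y - f x|] and that in [f] at most
    [e2 |phi y - phi x|], so the total error is at most
    [(e1 (|m| + e2) + e2 |l|) |phi y - phi x|]; the choice below, with [e2 <= 1], makes
    each of the two contributions at most [eps / 2]. *)
Lemma derives_along_comp (G : C -> C) f l m :
  filterlim phi F (@locally C_UniformSpace (phi x)) ->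
  is_C_derive G (f x) l -> derives_along F phi f x m ->
  derives_along F phi (fun y => G (f y)) x (m * l).
Proof.
  intros Hphi HG Hf eps.
  assert (Hc := derives_along_continuous f m Hphi Hf).
  assert (Hl : (0 < 2 * (Cmod l + 1))%R) by (generalize (Cmod_ge_0 l); lra).
  assert (Hm : (0 < 2 * (Cmod m + 1))%R) by (generalize (Cmod_ge_0 m); lra).
  set (e1 := mkposreal _ (Rdiv_lt_0_compat _ _ (cond_pos eps) Hm)).
  set (e2 := mkposreal _ (Rmin_pos _ _ Rlt_0_1 (Rdiv_lt_0_compat _ _ (cond_pos eps) Hl))).
  apply is_C_derive_along in HG.
  assert (HGf : F (fun y =>
    (Cmod (G (f y) - G (f x) - (f y - f x) * l) <= e1 * Cmod (f y - f x))%R))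
    by exact (Hc _ (HG e1)).
  generalize (filter_and _ _ HGf (Hf e2)). clear HG Hc HGf.
  apply filter_imp. intros y [H1 H2].
  assert (E2a : (e2 <= 1)%R) by apply Rmin_l.
  assert (E2b : (e2 <= eps / (2 * (Cmod l + 1)))%R) by apply Rmin_r.
  assert (E1 : (e1 * (Cmod m + 1) = eps / 2)%R) by (unfold e1; simpl; field; lra).
  assert (E2 : (e2 * (Cmod l + 1) <= eps / 2)%R).
  { apply Rle_trans with (eps / (2 * (Cmod l + 1)) * (Cmod l + 1))%R.
    - apply Rmult_le_compat_r; lra.
    - right; field; lra. }
  assert (P1 := cond_pos e1). assert (P2 := cond_pos e2).
  revert H1 H2 E1 E2 E2a P1 P2. generalize (pos e1) (pos e2). clear e1 e2 E2b.
  intros e1 e2 H1 H2 E1 E2 E2a P1 P2.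
  replace (G (f y) - G (f x) - (phi y - phi x) * (m * l)) with
    ((G (f y) - G (f x) - (f y - f x) * l) + (f y - f x - (phi y - phi x) * m) * l) by ring.
  eapply Rle_trans; [apply Cmod_triangle|]. rewrite Cmod_mult.
  assert (H3 : (Cmod (f y - f x) <= (Cmod m + 1) * Cmod (phi y - phi x))%R).
  { replace (f y - f x) with ((f y - f x - (phi y - phi x) * m) + (phi y - phi x) * m) by ring.
    eapply Rle_trans; [apply Cmod_triangle|]. rewrite Cmod_mult.
    generalize (Cmod_ge_0 (phi y - phi x)). nra. }
  generalize (Cmod_ge_0 (phi y - phi x)) (Cmod_ge_0 l). intros Q1 Q2.
  set (D := Cmod (phi y - phi x)) in *.
  assert (H4 : (e1 * Cmod (f y - f x) <= eps / 2 * D)%R).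
  { rewrite <- E1. rewrite Rmult_assoc. apply Rmult_le_compat_l; lra. }
  assert (H5 : (Cmod (f y - f x - (phi y - phi x) * m) * Cmod l <= eps / 2 * D)%R).
  { apply Rle_trans with (e2 * D * Cmod l)%R. { now apply Rmult_le_compat_r. }
    apply Rle_trans with (e2 * (Cmod l + 1) * D)%R. 2: now apply Rmult_le_compat_r.
    nra. }
  lra.
Qed.

End Along.

(** * The complex exponential and branches of the logarithm *)

Lemma Cexp_plus a b : Cexp (a + b) = Cexp a * Cexp b.
Proof.
  unfold Cexp. rewrite re_plus, im_plus, exp_plus, cos_plus, sin_plus.
  apply injective_projections; simpl; ring.
Qed.

Lemma Cexp_0 : Cexp 0 = 1.
Proof. unfold Cexp. simpl. rewrite exp_0, cos_0, sin_0. apply injective_projections; simpl; ring. Qed.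

Lemma Cexp_nz z : Cexp z <> 0.
Proof.
  intros H. assert (K : Cexp z * Cexp (- z) = 1).
  { rewrite <- Cexp_plus, <- Cexp_0. f_equal. ring. }
  rewrite H, Cmult_0_l in K. apply C1_nz. now symmetry.
Qed.

Lemma derivable_pt_lim_estimate (f : R -> R) (l : R) :
  derivable_pt_lim f 0 l -> forall eps : posreal, exists d : posreal,
  forall h, (Rabs h < d -> Rabs (f h - f 0 - l * h) <= eps * Rabs h)%R.
Proof.
  intros H eps. destruct (H eps (cond_pos eps)) as [d Hd]. exists d. intros h Hh.
  destruct (Req_dec h 0) as [->|Hn].
  - replace (f 0 - f 0 - l * 0)%R with 0%R by ring. rewrite Rabs_R0. lra.
  - specialize (Hd h Hn Hh). rewrite Rplus_0_l in Hd.
    replace (f h - f 0 - l * h)%R with (((f h - f 0) / h - l) * h)%R by (field; easy).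
    rewrite Rabs_mult. apply Rmult_le_compat_r; [apply Rabs_pos | lra].
Qed.

Lemma Cmod_le_Re_Im z : (Cmod z <= Rabs (Re z) + Rabs (Im z))%R.
Proof.
  replace z with ((RtoC (Re z)) + Ci * RtoC (Im z)) at 1
    by (apply injective_projections; unfold Re, Im; simpl; ring).
  eapply Rle_trans; [apply Cmod_triangle|]. rewrite Cmod_mult, Cmod_Ci, !Cmod_R. lra.
Qed.

Lemma im_le_Cmod z : (Rabs (Im z) <= Cmod z)%R.
Proof. eapply Rle_trans; [|apply Rmax_Cmod]. apply Rmax_r. Qed.

(** With [h = a + i b], the error [Cexp h - 1 - h] equals
      [(exp a - 1 - a) + exp a ((cos b - 1) + i (sin b - b)) + i b (exp a - 1)],
    so the real derivatives of [exp], [cos] and [sin] at [0] control it. *)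
Lemma Cexp_estimate_0 (eps : posreal) : exists d : posreal,
  forall h, (Cmod h < d -> Cmod (Cexp h - 1 - h) <= eps * Cmod h)%R.
Proof.
  (* the four parts of the error add up to at most (1 + 3 + 3 + 2) e |h|, hence eps / 10 *)
  assert (He : (0 < Rmin 1 (eps / 10))%R)
    by (apply Rmin_pos; generalize (cond_pos eps); lra).
  destruct (derivable_pt_lim_estimate _ _ (derivable_pt_lim_exp 0) (mkposreal _ He)) as [d1 H1].
  destruct (derivable_pt_lim_estimate _ _ (derivable_pt_lim_cos 0) (mkposreal _ He)) as [d2 H2].
  destruct (derivable_pt_lim_estimate _ _ (derivable_pt_lim_sin 0) (mkposreal _ He)) as [d3 H3].
  rewrite exp_0 in H1. rewrite cos_0, sin_0 in H2. rewrite cos_0, sin_0 in H3. simpl in *.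
  assert (A := Rmin_l 1 (eps / 10)). assert (B := Rmin_r 1 (eps / 10)).
  revert He H1 H2 H3 A B. generalize (Rmin 1 (eps / 10)). intros e He H1 H2 H3 A B.
  assert (Hd : (0 < Rmin (Rmin d1 d2) (Rmin d3 e))%R)
    by (repeat apply Rmin_pos; try apply cond_pos; exact He).
  exists (mkposreal _ Hd). simpl. intros h Hh.
  assert (Hh1 := Rlt_le_trans _ _ _ Hh (Rmin_l _ _)).
  assert (Hh2 := Rlt_le_trans _ _ _ Hh (Rmin_r _ _)).
  assert (K1 := Rlt_le_trans _ _ _ Hh1 (Rmin_l _ _)).
  assert (K2 := Rlt_le_trans _ _ _ Hh1 (Rmin_r _ _)).
  assert (K3 := Rlt_le_trans _ _ _ Hh2 (Rmin_l _ _)).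
  assert (K4 := Rlt_le_trans _ _ _ Hh2 (Rmin_r _ _)).
  assert (R1 := re_le_Cmod h). assert (R2 := im_le_Cmod h).
  specialize (H1 (Re h) (Rle_lt_trans _ _ _ R1 K1)).
  specialize (H2 (Im h) (Rle_lt_trans _ _ _ R2 K2)).
  specialize (H3 (Im h) (Rle_lt_trans _ _ _ R2 K3)).
  set (a := Re h) in *. set (b := Im h) in *. set (m := Cmod h) in *.
  assert (P1 := Rabs_pos a). assert (P2 := Rabs_pos b).
  assert (X1 : (Rabs (exp a - 1 - a) <= e * m)%R).
  { replace (exp a - 1 - a)%R with (exp a - 1 - 1 * a)%R by ring. nra. }
  assert (X2 : (Rabs (cos b - 1) <= e * m)%R).
  { replace (cos b - 1)%R with (cos b - 1 - - 0 * b)%R by ring. nra. }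
  assert (X3 : (Rabs (sin b - b) <= e * m)%R).
  { replace (sin b - b)%R with (sin b - 0 - 1 * b)%R by ring. nra. }
  assert (X4 : (Rabs (exp a - 1) <= 2 * m)%R).
  { replace (exp a - 1)%R with ((exp a - 1 - a) + a)%R by ring.
    eapply Rle_trans; [apply Rabs_triang|]. nra. }
  assert (X5 : (Rabs (exp a) <= 3)%R).
  { replace (exp a)%R with ((exp a - 1) + 1)%R by ring.
    eapply Rle_trans; [apply Rabs_triang|]. rewrite Rabs_R1. lra. }
  eapply Rle_trans; [apply Cmod_le_Re_Im|].
  replace (Re (Cexp h - 1 - h)) with ((exp a - 1 - a) + exp a * (cos b - 1))%R
    by (unfold a, b, Cexp, Re, Im; simpl; ring).
  replace (Im (Cexp h - 1 - h)) with ((exp a) * (sin b - b) + b * (exp a - 1))%R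
    by (unfold a, b, Cexp, Re, Im; simpl; ring).
  assert (Y1 := Rabs_triang (exp a - 1 - a) (exp a * (cos b - 1))).
  assert (Y2 := Rabs_triang (exp a * (sin b - b)) (b * (exp a - 1))).
  rewrite Rabs_mult in Y1. rewrite !Rabs_mult in Y2.
  assert (Z1 : (Rabs (exp a) * Rabs (cos b - 1) <= 3 * (e * m))%R)
    by (apply Rmult_le_compat; try apply Rabs_pos; assumption).
  assert (Z2 : (Rabs (exp a) * Rabs (sin b - b) <= 3 * (e * m))%R)
    by (apply Rmult_le_compat; try apply Rabs_pos; assumption).
  assert (Z3 : (Rabs b * Rabs (exp a - 1) <= e * (2 * m))%R)
    by (apply Rmult_le_compat; try apply Rabs_pos; lra).
  assert (m * (10 * e) <= m * eps)%R by (apply Rmult_le_compat_l; lra).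
  assert (0 <= e * m)%R by (apply Rmult_le_pos; lra).
  lra.
Qed.

Lemma is_C_derive_Cexp z : is_C_derive Cexp z (Cexp z).
Proof.
  apply is_C_derive_along. intros eps.
  assert (Hz : (0 < Cmod (Cexp z))%R) by apply Cmod_gt_0, Cexp_nz.
  destruct (Cexp_estimate_0 (mkposreal _ (Rdiv_lt_0_compat _ _ (cond_pos eps) Hz))) as [d Hd].
  apply locally_Cmod. exists d. intros y Hy. specialize (Hd _ Hy). simpl in Hd.
  replace (Cexp y) with (Cexp z * Cexp (y - z)) by (rewrite <- Cexp_plus; f_equal; ring).
  replace (Cexp z * Cexp (y - z) - Cexp z - (y - z) * Cexp z)
    with (Cexp z * (Cexp (y - z) - 1 - (y - z))) by ring.
  rewrite Cmod_mult.
  apply Rle_trans with (Cmod (Cexp z) * (eps / Cmod (Cexp z) * Cmod (y - z)))%R.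
  - apply Rmult_le_compat_l; lra.
  - right; field; lra.
Qed.

(** If [h = L y - L x], then [phi y - phi x = phi x (Cexp h - 1)], and [Cexp h - 1] is
    [h] up to an error that is small compared with [h] because [L] is continuous.  It
    remains to measure this error against [Cexp h - 1] instead of [h], which is possible
    as [|h| <= 2 |Cexp h - 1|] for small [h]. *)
Lemma log_branch_derives_along {T : Type} (F : (T -> Prop) -> Prop) {FF : Filter F}
    (phi L : T -> C) (x : T) :
  filterlim L F (@locally C_UniformSpace (L x)) ->
  Cexp (L x) = phi x -> F (fun y => Cexp (L y) = phi y) ->
  derives_along F phi L x (/ phi x).
Proof.
  intros HL Hx HF eps.
  assert (Hn : phi x <> 0) by (rewrite <- Hx; apply Cexp_nz).
  assert (Hp : (0 < Cmod (phi x))%R) by now apply Cmod_gt_0.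
  assert (He : (0 < Rmin (1 / 2) (eps * Cmod (phi x) / 2))%R).
  { assert (H := Rmult_lt_0_compat _ _ (cond_pos eps) Hp). apply Rmin_pos; lra. }
  destruct (Cexp_estimate_0 (mkposreal _ He)) as [d Hd]. simpl in Hd.
  assert (A := Rmin_l (1 / 2) (eps * Cmod (phi x) / 2)).
  assert (B := Rmin_r (1 / 2) (eps * Cmod (phi x) / 2)).
  revert He Hd A B. generalize (Rmin (1 / 2) (eps * Cmod (phi x) / 2)). intros e He Hd A B.
  generalize (filter_and _ _ HF (proj1 (filterlim_Cmod F L (L x)) HL d)).
  apply filter_imp. intros y [Hy Hy']. specialize (Hd _ Hy').
  set (h := L y - L x) in *.
  assert (E : phi y - phi x = phi x * (Cexp h - 1)).
  { rewrite <- Hy, <- Hx.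
    replace (L y) with (L x + h) by (unfold h; ring). rewrite Cexp_plus. ring. }
  rewrite E.
  replace (h - phi x * (Cexp h - 1) * / phi x) with (- (Cexp h - 1 - h)) by (field; easy).
  rewrite Cmod_opp, Cmod_mult.
  assert (H2 : (Cmod h <= 2 * Cmod (Cexp h - 1))%R).
  { assert (K : (Cmod h <= Cmod (Cexp h - 1) + Cmod (Cexp h - 1 - h))%R).
    { replace h with ((Cexp h - 1) + - (Cexp h - 1 - h)) at 1 by ring.
      eapply Rle_trans; [apply Cmod_triangle|]. rewrite Cmod_opp. lra. }
    generalize (Cmod_ge_0 h). nra. }
  generalize (Cmod_ge_0 (Cexp h - 1)). intros Q.
  apply Rle_trans with (e * (2 * Cmod (Cexp h - 1)))%R. { nra. }
  nra.
Qed.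

(** * Absolutely convergent complex series *)

Lemma sum_n_Re (a : nat -> C) n : Re (sum_n a n) = sum_n (fun k => Re (a k)) n.
Proof. induction n. { now rewrite !sum_O. } rewrite !sum_Sn, <- IHn. reflexivity. Qed.

Lemma sum_n_Im (a : nat -> C) n : Im (sum_n a n) = sum_n (fun k => Im (a k)) n.
Proof. induction n. { now rewrite !sum_O. } rewrite !sum_Sn, <- IHn. reflexivity. Qed.

Lemma is_Cseries_components (a : nat -> C) (l : C) :
  is_Cseries a l <->
  is_series (fun k => Re (a k)) (Re l) /\ is_series (fun k => Im (a k)) (Im l).
Proof.
  unfold is_Cseries, is_series. split.
  - intros H. split.
    + apply filterlim_ext with (fun n => Re (sum_n a n)). { apply sum_n_Re. }
      eapply filterlim_comp. { exact H. } destruct l as [l1 l2].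
      intros P [d Hd]. exists d. intros [y1 y2] [Hy _]. apply Hd, Hy.
    + apply filterlim_ext with (fun n => Im (sum_n a n)). { apply sum_n_Im. }
      eapply filterlim_comp. { exact H. } destruct l as [l1 l2].
      intros P [d Hd]. exists d. intros [y1 y2] [_ Hy]. apply Hd, Hy.
  - intros [H1 H2]. intros P [d Hd]. 
    assert (K1 := H1 _ (locally_ball _ d)). assert (K2 := H2 _ (locally_ball _ d)).
    unfold filtermap in *. generalize (filter_and _ _ K1 K2). apply filter_imp.
    intros n [B1 B2]. apply Hd. split.
    + rewrite <- sum_n_Re in B1. exact B1.
    + rewrite <- sum_n_Im in B2. exact B2.
Qed.

Lemma CSeries_unique (a : nat -> C) (l : C) : is_Cseries a l -> CSeries a = l.
Proof.
  intros H. apply is_Cseries_components in H. destruct H as [H1 H2].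
  unfold CSeries. rewrite (is_series_unique _ _ H1), (is_series_unique _ _ H2).
  now destruct l.
Qed.

Definition abs_summable (a : nat -> C) : Prop := ex_series (fun k => Cmod (a k)).

Lemma abs_summable_le (a : nat -> C) (b : nat -> R) :
  (forall k, (Cmod (a k) <= b k)%R) -> ex_series b -> abs_summable a.
Proof.
  intros H Hb. apply @ex_series_le with b; [|exact Hb].
  intros n. change (Rabs (Cmod (a n)) <= b n)%R. rewrite Rabs_pos_eq; [apply H | apply Cmod_ge_0].
Qed.

Lemma abs_summable_is_Cseries (a : nat -> C) : abs_summable a -> is_Cseries a (CSeries a).
Proof.
  intros H. apply is_Cseries_components. split; apply Series_correct.
  - apply @ex_series_le with (fun k => Cmod (a k)); [|exact H]. intros n. apply re_le_Cmod.
  - apply @ex_series_le with (fun k => Cmod (a k)); [|exact H]. intros n. apply im_le_Cmod.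
Qed.

Lemma Cmod_CSeries_le (a : nat -> C) (b : nat -> R) :
  (forall k, (Cmod (a k) <= b k)%R) -> ex_series b -> (Cmod (CSeries a) <= Series b)%R.
Proof.
  intros H Hb.
  assert (Ha := abs_summable_is_Cseries a (abs_summable_le a b H Hb)).
  assert (K : forall n, (Cmod (sum_n a n) <= sum_n b n)%R).
  { induction n. { rewrite !sum_O. apply H. }
    rewrite !sum_Sn. eapply Rle_trans; [apply Cmod_triangle|].
    apply Rplus_le_compat; [exact IHn | apply H]. }
  apply Series_correct in Hb.
  apply (filterlim_le (F := eventually) (fun n => norm (sum_n a n)) (sum_n b)
     (norm (CSeries a)) (Series b)).
  - exists 0%nat. intros n _. apply K.
  - eapply filterlim_comp; [exact Ha|]. apply (filterlim_norm (CSeries a)).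
  - exact Hb.
Qed.

Lemma CSeries_ext (a b : nat -> C) : (forall k, a k = b k) -> CSeries a = CSeries b.
Proof.
  intros H. unfold CSeries. f_equal; apply Series_ext; intros k; now rewrite H.
Qed.

Lemma is_Cseries_minus (a b : nat -> C) (la lb : C) :
  is_Cseries a la -> is_Cseries b lb -> is_Cseries (fun k => a k - b k) (la - lb).
Proof. apply (@is_series_minus C_AbsRing C_NormedModule). Qed.

Lemma is_Cseries_scal (c : C) (a : nat -> C) (l : C) :
  is_Cseries a l -> is_Cseries (fun k => c * a k) (c * l).
Proof. apply (@is_series_scal C_AbsRing C_NormedModule). Qed.

(** Summing the bounds on the remainders leaves [(sum M_k) |h|^2], which is
    [o(h)].  The same bounds yield the convergence of the series at [z + h]. *)
Theorem is_C_derive_CSeries (u : nat -> C -> C) (v : nat -> C) (M : nat -> R)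
    (z : C) (d : posreal) :
  abs_summable (fun k => u k z) -> abs_summable v -> ex_series M ->
  (forall k h, (Cmod h < d)%R ->
     (Cmod (u k (z + h)%C - u k z - h * v k) <= M k * Cmod h ^ 2)%R) ->
  is_C_derive (fun y => CSeries (fun k => u k y)) z (CSeries v).
Proof.
  intros Hu Hv HM Hrem. apply is_C_derive_along. intros eps. apply locally_Cmod.
  assert (HS : (0 < Rabs (Series M) + 1)%R) by (generalize (Rabs_pos (Series M)); lra).
  assert (Hd : (0 < Rmin d (eps / (Rabs (Series M) + 1)))%R).
  { apply Rmin_pos; [apply cond_pos | apply Rdiv_lt_0_compat; [apply cond_pos | exact HS]]. }
  exists (mkposreal _ Hd). simpl. intros y Hy.
  assert (Hy1 := Rlt_le_trans _ _ _ Hy (Rmin_l _ _)).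
  assert (Hy2 := Rlt_le_trans _ _ _ Hy (Rmin_r _ _)).
  set (h := y - z) in *.
  assert (Hr : forall k, (Cmod (u k y - u k z - h * v k) <= M k * Cmod h ^ 2)%R).
  { intros k. replace y with (z + h) by (unfold h; ring). now apply Hrem. }
  assert (Huy : abs_summable (fun k => u k y)).
  { apply abs_summable_le with
      (fun k => M k * Cmod h ^ 2 + (Cmod (u k z) + Cmod h * Cmod (v k)))%R.
    - intros k.
      replace (u k y) with ((u k y - u k z - h * v k) + (u k z + h * v k)) by ring.
      eapply Rle_trans; [apply Cmod_triangle|]. apply Rplus_le_compat; [apply Hr|].
      eapply Rle_trans; [apply Cmod_triangle|]. rewrite Cmod_mult. lra.
    - apply (ex_series_plus (V := R_NormedModule)).
      + apply ex_series_scal_r, HM.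
      + apply (ex_series_plus (V := R_NormedModule)); [exact Hu|].
        exact (ex_series_scal_l (Cmod h) (fun k => Cmod (v k)) Hv). }
  replace (CSeries (fun k => u k y) - CSeries (fun k => u k z) - h * CSeries v)
    with (CSeries (fun k => u k y - u k z - h * v k)).
  2:{ apply CSeries_unique.
      apply is_Cseries_minus; [apply is_Cseries_minus|apply is_Cseries_scal];
        now apply abs_summable_is_Cseries. }
  eapply Rle_trans; [apply (Cmod_CSeries_le _ _ Hr), ex_series_scal_r, HM|].
  rewrite Series_scal_r. assert (Q := Cmod_ge_0 h).
  apply Rle_trans with ((Rabs (Series M) + 1) * Cmod h ^ 2)%R.
  { apply Rmult_le_compat_r; [apply pow2_ge_0 | generalize (Rle_abs (Series M)); lra]. }
  apply Rle_trans with ((Rabs (Series M) + 1) * (eps / (Rabs (Series M) + 1)) * Cmod h)%R.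
  { replace (Cmod h ^ 2)%R with (Cmod h * Cmod h)%R by ring. rewrite <- Rmult_assoc.
    apply Rmult_le_compat_r; [exact Q|]. apply Rmult_le_compat_l; lra. }
  right. field. lra.
Qed.

(** * Power series and their radius of convergence *)

Lemma is_Cseries_bounded (a : nat -> C) (l : C) :
  is_Cseries a l -> exists M : R, forall n, (Cmod (a n) <= M)%R.
Proof.
  intros H.
  destruct (filterlim_bounded (K := C_AbsRing) (V := C_NormedModule) (sum_n a)) as [M HM].
  { exists l. exact H. }
  assert (HM' : forall n, (Cmod (sum_n a n) <= M)%R) by exact HM.
  exists (2 * M)%R. intros [|n].
  - generalize (HM' 0%nat) (Cmod_ge_0 (a 0%nat)). rewrite sum_O. lra.
  - replace (a (S n)) with (sum_n a (S n) + - sum_n a n).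
    2:{ rewrite sum_Sn. change (sum_n a n + a (S n) + - sum_n a n = a (S n)). ring. }
    eapply Rle_trans; [apply Cmod_triangle|]. rewrite Cmod_opp.
    generalize (HM' n) (HM' (S n)). lra.
Qed.

(** The terms of a convergent series are bounded, and the radius of convergence of a real
    power series is the supremum of the radii at which its terms are bounded.  Thus the
    theory of real power series provides absolute convergence inside the disc. *)
Lemma convergence_radius_le_CV_radius (a : nat -> C) :
  Rbar_le (convergence_radius a) (CV_radius (fun k => Cmod (a k))).
Proof.
  apply (proj2 (Lub_Rbar_correct _)). intros r (z & l & <- & H).
  apply (proj1 (CV_radius_bounded _)).
  destruct (is_Cseries_bounded _ _ H) as [M HM]. exists M. intros n.
  rewrite <- Cmod_pow, <- Cmod_mult, Rabs_pos_eq by apply Cmod_ge_0.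
  apply HM.
Qed.

Section PowerSeries.
Variable a : nat -> C.
Variable r : R.
Hypothesis r_ge0 : (0 <= r)%R.
Hypothesis r_lt : Rbar_lt r (convergence_radius a).

Lemma ex_series_Cmod_coef : ex_series (fun k => Cmod (a k) * r ^ k)%R.
Proof.
  apply ex_series_ext with (fun k => Rabs (Cmod (a k) * r ^ k)).
  { intros k. apply Rabs_pos_eq, Rmult_le_pos; [apply Cmod_ge_0 | now apply pow_le]. }
  apply CV_disk_inside. rewrite Rabs_pos_eq by exact r_ge0.
  eapply Rbar_lt_le_trans; [exact r_lt | apply convergence_radius_le_CV_radius].
Qed.

Lemma ex_series_Cmod_derived_coef :
  ex_series (fun k => INR (S k) * Cmod (a (S k)) * r ^ k)%R.
Proof.
  apply ex_series_ext with (fun k => Rabs (PS_derive (fun k => Cmod (a k)) k * r ^ k)).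
  { intros k. apply Rabs_pos_eq, Rmult_le_pos; [|now apply pow_le].
    apply Rmult_le_pos; [apply pos_INR | apply Cmod_ge_0]. }
  apply CV_disk_inside. rewrite CV_radius_derive, Rabs_pos_eq by exact r_ge0.
  eapply Rbar_lt_le_trans; [exact r_lt | apply convergence_radius_le_CV_radius].
Qed.

End PowerSeries.

Lemma Rbar_lt_between (s : R) (R0 : Rbar) :
  Rbar_lt s R0 -> exists r : R, (s < r)%R /\ Rbar_lt r R0.
Proof.
  destruct R0 as [t| |]; simpl; intros H.
  - exists ((s + t) / 2)%R. lra.
  - exists (s + 1)%R. split; [lra | exact I].
  - easy.
Qed.

(** If [T_k] is the remainder on the left, then
    [T_(k+1) = (w + h) T_k + (k+1) w^k h^2].  The factor [r] on the left avoids the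
    exponent [k - 1] in the bound. *)
Lemma Cpow_remainder (r : R) (w h : C) (k : nat) :
  (Cmod w <= r)%R -> (Cmod (w + h) <= r)%R ->
  (r * Cmod ((w + h) ^ S k - w ^ S k - h * (INR (S k) * w ^ k))
   <= INR (S k) ^ 2 * r ^ k * Cmod h ^ 2)%R.
Proof.
  intros Hw Hwh. assert (Hr : (0 <= r)%R) by (generalize (Cmod_ge_0 w); lra).
  assert (Hh := pow2_ge_0 (Cmod h)).
  induction k as [|k IH].
  - replace ((w + h) ^ 1 - w ^ 1 - h * (INR 1 * w ^ 0)) with (RtoC 0) by (simpl; ring).
    rewrite Cmod_0. simpl in *. lra.
  - set (T := (w + h) ^ S k - w ^ S k - h * (INR (S k) * w ^ k)) in *.
    replace ((w + h) ^ S (S k) - w ^ S (S k) - h * (INR (S (S k)) * w ^ S k))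
      with ((w + h) * T + INR (S k) * w ^ k * (h * h)).
    2:{ unfold T. rewrite (S_INR (S k)), RtoC_plus, !(Cpow_S _ (S k)), !(Cpow_S _ k). ring. }
    apply Rle_trans with (r * (r * Cmod T + INR (S k) * r ^ k * Cmod h ^ 2))%R.
    { apply Rmult_le_compat_l; [exact Hr|].
      eapply Rle_trans; [apply Cmod_triangle|]. rewrite !Cmod_mult, Cmod_pow, Cmod_R.
      rewrite (Rabs_pos_eq _ (pos_INR _)). apply Rplus_le_compat.
      - apply Rmult_le_compat_r; [apply Cmod_ge_0 | exact Hwh].
      - replace (Cmod h ^ 2)%R with (Cmod h * Cmod h)%R by ring.
        apply Rmult_le_compat_r; [generalize (Cmod_ge_0 h); nra|].
        apply Rmult_le_compat_l; [apply pos_INR|].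
        apply pow_incr. split; [apply Cmod_ge_0 | exact Hw]. }
    assert (Hn := pos_INR (S k)). assert (Hp := pow_le r k Hr).
    rewrite (S_INR (S k)). simpl (r ^ S k)%R.
    assert (K : (0 <= r * r ^ k * Cmod h ^ 2)%R)
      by (apply Rmult_le_pos; [apply Rmult_le_pos|]; assumption).
    apply Rle_trans with (r * ((INR (S k) ^ 2 + INR (S k)) * r ^ k * Cmod h ^ 2))%R.
    { apply Rmult_le_compat_l; [exact Hr|]. lra. }
    apply Rle_trans with ((INR (S k) ^ 2 + INR (S k)) * (r * r ^ k * Cmod h ^ 2))%R.
    { right. ring. }
    apply Rle_trans with ((INR (S k) + 1) ^ 2 * (r * r ^ k * Cmod h ^ 2))%R.
    { apply Rmult_le_compat_r; [exact K|]. nra. }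
    right. ring.
Qed.

Lemma INR_S_nz (k : nat) : RtoC (INR (S k)) <> 0.
Proof. intros H. apply RtoC_inj in H. now apply (not_0_INR (S k)). Qed.

(** The antiderivative of [(sum_n a_n w^n - a_0) / w] that vanishes at [0]. *)
Definition log_primitive (a : nat -> C) (w : C) : C :=
  CSeries (fun k => a (S k) / INR (S k) * w ^ S k).

(** Termwise differentiation within a disc of radius [r > |w|] still inside the disc of
    convergence.  The term of index [k] is divided by [k + 1], so one of the two factors
    [k + 1] of [Cpow_remainder] cancels, and the derived series of moduli is summable. *)
Lemma is_C_derive_log_primitive (a : nat -> C) (w : C) :
  Rbar_lt (Cmod w) (convergence_radius a) ->
  is_C_derive (log_primitive a) w (CSeries (fun k => a (S k) * w ^ k)).
Proof.
  intros Hw. destruct (Rbar_lt_between _ _ Hw) as (r & Hwr & Hr).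
  assert (Hw0 := Cmod_ge_0 w). assert (r_pos : (0 < r)%R) by lra.
  assert (Hd : (0 < r - Cmod w)%R) by lra.
  assert (Hsum := ex_series_Cmod_derived_coef a r (Rlt_le _ _ r_pos) Hr).
  assert (Hterm : forall k, (1 <= INR (S k))%R)
    by (intros k; rewrite S_INR; generalize (pos_INR k); lra).
  apply is_C_derive_CSeries with
    (M := (fun k => INR (S k) * Cmod (a (S k)) * r ^ k * / r)%R)
    (d := mkposreal _ Hd).
  - apply abs_summable_le with
      (fun k => (INR (S k) * Cmod (a (S k)) * r ^ k) * r)%R; [|now apply ex_series_scal_r].
    intros k. specialize (Hterm k).
    rewrite Cmod_mult, Cmod_pow, Cmod_div, Cmod_R by apply INR_S_nz.
    rewrite Rabs_pos_eq by apply pos_INR.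
    replace (INR (S k) * Cmod (a (S k)) * r ^ k * r)%R
      with (INR (S k) * Cmod (a (S k)) * r ^ S k)%R by (simpl; ring).
    apply Rmult_le_compat; [| apply pow_le, Cmod_ge_0 | | apply pow_incr; lra].
    + apply Rmult_le_pos; [apply Cmod_ge_0|]. left. apply Rinv_0_lt_compat. lra.
    + unfold Rdiv. rewrite (Rmult_comm (Cmod _)). apply Rmult_le_compat_r; [apply Cmod_ge_0|].
      apply Rle_trans with 1%R; [|exact Hterm].
      rewrite <- Rinv_1. apply Rinv_le_contravar; lra.
  - apply abs_summable_le with (2 := Hsum).
    intros k. specialize (Hterm k). rewrite Cmod_mult, Cmod_pow.
    apply Rmult_le_compat; [apply Cmod_ge_0 | apply pow_le, Cmod_ge_0 | | apply pow_incr; lra].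
    generalize (Cmod_ge_0 (a (S k))). nra.
  - now apply ex_series_scal_r.
  - simpl pos. intros k h Hh.
    assert (K : (r * Cmod ((w + h) ^ S k - w ^ S k - h * (INR (S k) * w ^ k))
                 <= INR (S k) ^ 2 * r ^ k * Cmod h ^ 2)%R).
    { apply Cpow_remainder; [lra|]. eapply Rle_trans; [apply Cmod_triangle|]. lra. }
    replace (a (S k) / INR (S k) * (w + h) ^ S k - a (S k) / INR (S k) * w ^ S k
             - h * (a (S k) * w ^ k))
      with (a (S k) / INR (S k) * ((w + h) ^ S k - w ^ S k - h * (INR (S k) * w ^ k)))
      by (field; apply INR_S_nz).
    rewrite Cmod_mult, Cmod_div, Cmod_R by apply INR_S_nz.
    rewrite Rabs_pos_eq by apply pos_INR.
    revert K. generalize (Cmod ((w + h) ^ S k - w ^ S k - h * (INR (S k) * w ^ k))).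
    intros t K. specialize (Hterm k).
    apply Rle_trans with (Cmod (a (S k)) / INR (S k) * / r * (r * t))%R.
    { right. field. lra. }
    apply Rle_trans with
      (Cmod (a (S k)) / INR (S k) * / r * (INR (S k) ^ 2 * r ^ k * Cmod h ^ 2))%R.
    { apply Rmult_le_compat_l; [|exact K].
      apply Rmult_le_pos; [apply Rmult_le_pos; [apply Cmod_ge_0|]|];
        left; apply Rinv_0_lt_compat; lra. }
    right. field. lra.
Qed.

(** * The hypergeometrization at 1 + eps, 2 + eps as a function of eps *)

Lemma C_derive_n_derive (f : C -> C) (n : nat) :
  C_derive_n (C_derive f) n = C_derive_n f (S n).
Proof.
  induction n as [|n IH]; [reflexivity|].
  change (C_derive (C_derive_n (C_derive f) n) = C_derive (C_derive_n f (S n))).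
  now rewrite IH.
Qed.

Lemma coef_C_derive (f : C -> C) (k : nat) :
  coef k (C_derive f) = INR (S k) * coef (S k) f.
Proof.
  unfold coef. rewrite C_derive_n_derive.
  change (fact (S k)) with (S k * fact k)%nat. rewrite mult_INR, RtoC_mult.
  field. split; [|apply INR_S_nz].
  intros H. apply RtoC_inj in H. now apply (INR_fact_neq_0 k).
Qed.

Lemma Cmod_INR_S_plus_ge (k : nat) (e : C) :
  (Cmod e <= 1 / 2)%R -> (INR (S k) / 2 <= Cmod (INR (S k) + e))%R.
Proof.
  intros He. assert (Hk : (1 <= INR (S k))%R) by (rewrite S_INR; generalize (pos_INR k); lra).
  assert (H : (Cmod (INR (S k)) <= Cmod (INR (S k) + e) + Cmod e)%R).
  { replace (RtoC (INR (S k))) with ((INR (S k) + e) + - e) at 1 by ring.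
    eapply Rle_trans; [apply Cmod_triangle|]. rewrite Cmod_opp. lra. }
  rewrite Cmod_R, Rabs_pos_eq in H by lra. lra.
Qed.

Lemma INR_S_plus_nz (k : nat) (e : C) : (Cmod e <= 1 / 2)%R -> INR (S k) + e <> 0.
Proof.
  intros He. apply Cmod_gt_0. eapply Rlt_le_trans; [|now apply Cmod_INR_S_plus_ge].
  rewrite S_INR. generalize (pos_INR k). lra.
Qed.

Lemma pochhammer_two_plus_nz (e : C) (k : nat) :
  (Cmod e <= 1 / 2)%R -> pochhammer (2 + e) k <> 0.
Proof.
  intros He. induction k as [|k IH]; simpl; [apply C1_nz|].
  apply Cmult_neq_0; [exact IH|].
  replace (2 + e + INR k) with (INR (S (S k)) + e).
  - now apply INR_S_plus_nz.
  - rewrite !S_INR, !RtoC_plus. ring.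
Qed.

(** The two products share all factors but the first of one and the last of the other. *)
Lemma pochhammer_ratio (e : C) (k : nat) :
  (Cmod e <= 1 / 2)%R ->
  pochhammer (1 + e) k / pochhammer (2 + e) k = (1 + e) / (INR (S k) + e).
Proof.
  intros He.
  assert (H : pochhammer (1 + e) k * (INR (S k) + e) = pochhammer (2 + e) k * (1 + e)).
  { clear He. induction k as [|k IH]; [simpl; ring|].
    change (pochhammer (1 + e) (S k)) with (pochhammer (1 + e) k * (1 + e + INR k)).
    change (pochhammer (2 + e) (S k)) with (pochhammer (2 + e) k * (2 + e + INR k)).
    replace (1 + e + INR k) with (INR (S k) + e) by (rewrite S_INR, RtoC_plus; ring).
    rewrite IH, !S_INR, !RtoC_plus. ring. }
  assert (H1 := INR_S_plus_nz k e He). assert (H2 := pochhammer_two_plus_nz e k He).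
  replace (pochhammer (1 + e) k) with (pochhammer (2 + e) k * (1 + e) / (INR (S k) + e)).
  - field. now split.
  - rewrite <- H. field. exact H1.
Qed.

Lemma hyper_term_eq (f : C -> C) (e w : C) (k : nat) :
  (Cmod e <= 1 / 2)%R ->
  hyper_term (C_derive f) (1 + e) (2 + e) w k
  = INR (S k) * coef (S k) f * w ^ k * ((1 + e) / (INR (S k) + e)).
Proof.
  intros He. unfold hyper_term. rewrite pochhammer_ratio, coef_C_derive by exact He. ring.
Qed.

(** The factors [e |-> (1 + e) / (n + e) = 1 - (n - 1) / (n + e)] with [n = k + 1].  On
    the disc [|e| < 1/4] the pole stays at distance at least [n / 2], also after a shift
    by [|h| < 1/4], so all bounds are uniform in [k]. *)
Section Homography.
Variables (k : nat) (e h : C).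
Hypothesis e_small : (Cmod e < 1 / 4)%R.
Hypothesis h_small : (Cmod h < 1 / 4)%R.

Let n : R := INR (S k).

Let n_ge1 : (1 <= n)%R.
Proof. unfold n. rewrite S_INR. generalize (pos_INR k). lra. Qed.

Lemma homography_bound : (Cmod ((1 + e) / (n + e)) <= 4)%R.
Proof.
  assert (H1 := n_ge1).
  assert (He : (n / 2 <= Cmod (n + e))%R) by (apply Cmod_INR_S_plus_ge; lra).
  rewrite Cmod_div by (apply INR_S_plus_nz; lra).
  assert (H2 : (Cmod (1 + e) <= 2)%R).
  { eapply Rle_trans; [apply Cmod_triangle|]. rewrite Cmod_1. lra. }
  apply Rmult_le_reg_r with (Cmod (n + e)); [lra|].
  unfold Rdiv. rewrite Rmult_assoc, Rinv_l by lra. lra.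
Qed.

Lemma homography_derivative_bound : (Cmod (INR k / (n + e) ^ 2) <= 4)%R.
Proof.
  assert (H1 := n_ge1).
  assert (He : (n / 2 <= Cmod (n + e))%R) by (apply Cmod_INR_S_plus_ge; lra).
  assert (Hnz : n + e <> 0) by (apply INR_S_plus_nz; lra).
  rewrite Cmod_div by (now apply Cpow_nz).
  rewrite Cmod_pow, Cmod_R, (Rabs_pos_eq _ (pos_INR k)).
  assert (Hk : INR k = (n - 1)%R) by (unfold n; rewrite S_INR; ring).
  rewrite Hk. apply Rmult_le_reg_r with (Cmod (n + e) ^ 2)%R; [apply pow_lt; lra|].
  unfold Rdiv. rewrite Rmult_assoc, Rinv_l by (apply pow_nonzero; lra). nra.
Qed.

(** The expression inside the modulus is exactly
    [- (n - 1) h^2 / ((n + e + h) (n + e)^2)], whose denominator is at least [n^3 / 8]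
    in modulus. *)
Lemma homography_remainder :
  (Cmod ((1 + (e + h)) / (n + (e + h)) - (1 + e) / (n + e) - h * (INR k / (n + e) ^ 2))
   <= 8 * Cmod h ^ 2)%R.
Proof.
  assert (H1 := n_ge1).
  assert (He : (n / 2 <= Cmod (n + e))%R) by (apply Cmod_INR_S_plus_ge; lra).
  assert (Heh' : (Cmod (e + h) <= 1 / 2)%R).
  { eapply Rle_trans; [apply Cmod_triangle|]. lra. }
  assert (Heh : (n / 2 <= Cmod (n + (e + h)))%R) by now apply Cmod_INR_S_plus_ge.
  assert (Hnz : n + e <> 0) by (apply INR_S_plus_nz; lra).
  assert (Hnz' : n + (e + h) <> 0) by now apply INR_S_plus_nz.
  assert (Hk : INR k = (n - 1)%R) by (unfold n; rewrite S_INR; ring).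
  rewrite Hk, RtoC_minus.
  replace ((1 + (e + h)) / (n + (e + h)) - (1 + e) / (n + e) - h * ((n - 1) / (n + e) ^ 2))
    with (- (RtoC (n - 1) / ((n + (e + h)) * (n + e) ^ 2)) * (h * h)).
  2:{ rewrite RtoC_minus. field. now split. }
  assert (Hden : (n + (e + h)) * (n + e) ^ 2 <> 0)
    by (apply Cmult_neq_0; [|apply Cpow_nz]; assumption).
  rewrite Cmod_mult, Cmod_opp, Cmod_div, Cmod_R, !Cmod_mult, Cmod_pow by exact Hden.
  rewrite Rabs_pos_eq by lra.
  replace (Cmod h ^ 2)%R with (Cmod h * Cmod h)%R by ring.
  apply Rmult_le_compat_r; [generalize (Cmod_ge_0 h); nra|].
  assert (P1 : (n ^ 2 / 4 <= Cmod (n + e) ^ 2)%R) by nra.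
  assert (P2 : (n / 2 * (n ^ 2 / 4) <= Cmod (n + (e + h)) * Cmod (n + e) ^ 2)%R)
    by (apply Rmult_le_compat; nra).
  assert (P3 : (0 < n / 2 * (n ^ 2 / 4))%R) by nra.
  apply Rmult_le_reg_r with (Cmod (n + (e + h)) * Cmod (n + e) ^ 2)%R; [lra|].
  unfold Rdiv. rewrite Rmult_assoc, Rinv_l by lra. nra.
Qed.

End Homography.

Section Hypergeometrization.
Variables (f : C -> C) (w : C).
Hypothesis w_inside : Rbar_lt (Cmod w) (convergence_radius (fun k => coef k f)).

Let b (k : nat) : C := INR (S k) * coef (S k) f * w ^ k.

Let b_summable : ex_series (fun k => Cmod (b k)).
Proof.
  apply ex_series_ext with
    (2 := ex_series_Cmod_derived_coef (fun k => coef k f) _ (Cmod_ge_0 w) w_inside).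
  intros k. unfold b. now rewrite !Cmod_mult, Cmod_pow, Cmod_R, (Rabs_pos_eq _ (pos_INR (S k))).
Qed.

Lemma abs_summable_coef_mult (c : nat -> C) (M : R) :
  (forall k, (Cmod (c k) <= M)%R) -> abs_summable (fun k => b k * c k).
Proof.
  intros H. apply abs_summable_le with (fun k => Cmod (b k) * M)%R.
  - intros k. rewrite Cmod_mult. apply Rmult_le_compat_l; [apply Cmod_ge_0 | apply H].
  - now apply ex_series_scal_r.
Qed.

Lemma hyper_term_summable (e : C) :
  (Cmod e < 1 / 4)%R -> abs_summable (hyper_term (C_derive f) (1 + e) (2 + e) w).
Proof.
  intros He. apply abs_summable_le with
    (fun k => Cmod (b k * ((1 + e) / (INR (S k) + e)))).
  - intros k. rewrite hyper_term_eq by lra. apply Rle_refl.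
  - apply (abs_summable_coef_mult _ 4). intros k. now apply homography_bound.
Qed.

Lemma is_C_derive_hypergeometrization (e : C) :
  (Cmod e < 1 / 4)%R ->
  is_C_derive (fun e => hypergeometrization (C_derive f) (1 + e) (2 + e) w) e
    (CSeries (fun k => b k * (INR k / (INR (S k) + e) ^ 2))).
Proof.
  intros He.
  assert (Hd : (0 < 1 / 4)%R) by lra.
  assert (H : is_C_derive
    (fun e => CSeries (fun k => b k * ((1 + e) / (INR (S k) + e)))) e
    (CSeries (fun k => b k * (INR k / (INR (S k) + e) ^ 2)))).
  { apply is_C_derive_CSeries with
      (M := (fun k => Cmod (b k) * 8)%R) (d := mkposreal _ Hd).
    - apply (abs_summable_coef_mult _ 4). intros k. now apply homography_bound.
    - apply (abs_summable_coef_mult _ 4). intros k. now apply homography_derivative_bound.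
    - now apply ex_series_scal_r.
    - simpl pos. intros k h Hh.
      replace (b k * ((1 + (e + h)) / (INR (S k) + (e + h)))
               - b k * ((1 + e) / (INR (S k) + e))
               - h * (b k * (INR k / (INR (S k) + e) ^ 2)))
        with (b k * ((1 + (e + h)) / (INR (S k) + (e + h)) - (1 + e) / (INR (S k) + e)
               - h * (INR k / (INR (S k) + e) ^ 2))) by ring.
      rewrite Cmod_mult, Rmult_assoc. apply Rmult_le_compat_l; [apply Cmod_ge_0|].
      now apply homography_remainder. }
  apply is_C_derive_along in H. apply is_C_derive_along.
  assert (E : forall y, (Cmod y <= 1 / 2)%R ->
    CSeries (fun k => b k * ((1 + y) / (INR (S k) + y)))
    = hypergeometrization (C_derive f) (1 + y) (2 + y) w).
  { intros y Hy. apply CSeries_ext. intros k. now rewrite hyper_term_eq. }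
  eapply derives_along_ext; [apply locally_filter | | | exact H]; [|apply E; lra].
  apply locally_Cmod. exists (mkposreal _ Hd). simpl. intros y Hy. apply E.
  replace y with (e + (y - e)) by ring. eapply Rle_trans; [apply Cmod_triangle|]. lra.
Qed.

Lemma taylor_sum_split :
  is_Cseries (fun k => coef (S k) f * w ^ S k) (taylor_sum f w - f 0).
Proof.
  assert (H : is_Cseries (fun k => coef k f * w ^ k) (taylor_sum f w)).
  { apply abs_summable_is_Cseries.
    apply abs_summable_le with
      (2 := ex_series_Cmod_coef (fun k => coef k f) _ (Cmod_ge_0 w) w_inside).
    intros k. rewrite Cmod_mult, Cmod_pow. apply Rle_refl. }
  apply (@is_series_incr_1 C_AbsRing C_NormedModule (fun k => coef k f * w ^ k)).
  refine (eq_ind _ (is_Cseries _) H _ _).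
  change (taylor_sum f w = (taylor_sum f w - f 0) + f 0 / 1 * 1). field.
Qed.

(** Coefficientwise, for [n = k + 1]: [a_n - n a_n (n - 1) / n^2 = a_n / n]. *)
Lemma log_primitive_eq :
  taylor_sum f w - f 0
  - w * coef 1 (fun e => hypergeometrization (C_derive f) (1 + e) (2 + e) w)
  = log_primitive (fun k => coef k f) w.
Proof.
  assert (H0 : (Cmod 0 < 1 / 4)%R) by (rewrite Cmod_0; lra).
  replace (coef 1 (fun e => hypergeometrization (C_derive f) (1 + e) (2 + e) w))
    with (CSeries (fun k => b k * (INR k / (INR (S k) + 0) ^ 2))).
  2:{ unfold coef. simpl C_derive_n.
      rewrite (is_C_derive_unique _ _ _ (is_C_derive_hypergeometrization 0 H0)).
      simpl. field. }
  symmetry. unfold log_primitive. apply CSeries_unique.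
  assert (H : is_Cseries (fun k => coef (S k) f * w ^ S k
      - w * (b k * (INR k / (INR (S k) + 0) ^ 2)))
    (taylor_sum f w - f 0 - w * CSeries (fun k => b k * (INR k / (INR (S k) + 0) ^ 2)))).
  { apply is_Cseries_minus; [apply taylor_sum_split|]. apply is_Cseries_scal.
    apply abs_summable_is_Cseries, (abs_summable_coef_mult _ 4).
    intros k. now apply homography_derivative_bound. }
  revert H. apply is_series_ext. intros k. unfold b.
  assert (Hk := INR_S_nz k). rewrite Cpow_S.
  replace (RtoC (INR k)) with (INR (S k) - 1) by (rewrite S_INR, RtoC_plus; ring).
  rewrite Cplus_0_r.
  match goal with |- ?l = ?r => change (@eq C l r) end.
  field. exact Hk.
Qed.

Lemma log_primitive_derivative_eq :
  w * CSeries (fun k => coef (S k) f * w ^ k) = taylor_sum f w - f 0.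
Proof.
  rewrite <- (CSeries_unique _ _ taylor_sum_split). symmetry. apply CSeries_unique.
  apply is_series_ext with (fun k => w * (coef (S k) f * w ^ k)).
  { intros k. rewrite Cpow_S.
    match goal with |- ?l = ?r => change (@eq C l r) end. ring. }
  apply is_Cseries_scal, abs_summable_is_Cseries.
  apply abs_summable_le with (2 := b_summable).
  intros k. unfold b. rewrite !Cmod_mult, Cmod_R, Rabs_pos_eq by apply pos_INR.
  apply Rmult_le_compat_r; [apply Cmod_ge_0|].
  generalize (Cmod_ge_0 (coef (S k) f)) (pos_INR k). rewrite S_INR. nra.
Qed.

End Hypergeometrization.

(** * The antiderivative *)

(** By [log_primitive_eq] the function agrees, near [x], with
    [f 0 * L + log_primitive (Cexp (alpha * L)) / alpha], to which the chain rule applies. *)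
Lemma antiderivative_along {T : Type} (F : (T -> Prop) -> Prop) {FF : Filter F}
    (phi L : T -> C) (f : C -> C) (alpha : C) (x : T) :
  alpha <> 0 ->
  filterlim phi F (@locally C_UniformSpace (phi x)) ->
  filterlim L F (@locally C_UniformSpace (L x)) ->
  Cexp (L x) = phi x -> F (fun y => Cexp (L y) = phi y) ->
  Rbar_lt (Cmod (power L alpha x)) (convergence_radius (fun k => coef k f)) ->
  F (fun y => Rbar_lt (Cmod (power L alpha y)) (convergence_radius (fun k => coef k f))) ->
  derives_along F phi
    (fun x => f 0 * L x
       + (taylor_sum f (power L alpha x) - f 0) / alpha
       - power L alpha x / alpha
         * coef 1 (fun eps : C =>
             hypergeometrization (C_derive f) (1 + eps) (2 + eps) (power L alpha x)))
    x (1 / phi x * taylor_sum f (power L alpha x)).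
Proof.
  intros Ha Hphi HL Hx HF Hin HFin.
  assert (Hn : phi x <> 0) by (rewrite <- Hx; apply Cexp_nz).
  assert (DL := log_branch_derives_along F phi L x HL Hx HF).
  assert (Dw : derives_along F phi (power L alpha) x (alpha * / phi x * power L alpha x)).
  { apply (derives_along_comp F phi x Cexp (fun y => alpha * L y)); [exact Hphi | | ].
    - apply is_C_derive_Cexp.
    - now apply derives_along_scal. }
  assert (DS := derives_along_comp F phi x _ _ _ _ Hphi
    (is_C_derive_log_primitive _ _ Hin) Dw).
  assert (E : forall y,
    Rbar_lt (Cmod (power L alpha y)) (convergence_radius (fun k => coef k f)) ->
    f 0 * L y + / alpha * log_primitive (fun k => coef k f) (power L alpha y)
    = f 0 * L y
       + (taylor_sum f (power L alpha y) - f 0) / alpha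
       - power L alpha y / alpha
         * coef 1 (fun eps : C =>
             hypergeometrization (C_derive f) (1 + eps) (2 + eps) (power L alpha y))).
  { intros y Hy. rewrite <- log_primitive_eq by exact Hy. field. exact Ha. }
  apply derives_along_ext with (3 := E x Hin)
    (f := fun y => f 0 * L y
                   + / alpha * log_primitive (fun k => coef k f) (power L alpha y)).
  - exact FF.
  - revert HFin. apply filter_imp. exact E.
  - replace (1 / phi x * taylor_sum f (power L alpha x)) with
      (f 0 * / phi x + / alpha * (alpha * / phi x * power L alpha x
         * CSeries (fun k => coef (S k) f * power L alpha x ^ k))).
    + apply derives_along_plus; [exact FF | |]; now apply derives_along_scal.
    + replace (taylor_sum f (power L alpha x)) with
        (f 0 + power L alpha x * CSeries (fun k => coef (S k) f * power L alpha x ^ k)).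
      * field. now split.
      * rewrite log_primitive_derivative_eq by exact Hin. ring.
Qed.

Theorem proposition2 :
  forall (f : C -> C) (R0 : Rbar) (alpha : C),
  holomorphic_near f 0 ->
  R0 = convergence_radius (fun k => coef k f) ->
  Rbar_lt 0 R0 ->
  alpha <> 0 ->
  (* the coefficient [eps] below is taken of a convergent sum, holomorphic near eps = 0 *)
  (forall w : C, Rbar_lt (Cmod w) R0 ->
     @locally C_UniformSpace (RtoC 0) (fun eps : C =>
       exists l : C, is_Cseries (hyper_term (C_derive f) (1 + eps) (2 + eps) w) l) /\
     holomorphic_near
       (fun eps : C => hypergeometrization (C_derive f) (1 + eps) (2 + eps) w) 0) /\
  (* complex variable *)
  (forall (U : C -> Prop) (L : C -> C),
     C_open U -> C_connected U -> ~ U 0 ->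
     ln_branch U L ->
     (forall x : C, U x -> Rbar_lt (Cmod (power L alpha x)) R0) ->
     forall x : C, U x ->
     is_C_derive
       (fun x : C =>
          f 0 * L x
          + (taylor_sum f (power L alpha x) - f 0) / alpha
          - power L alpha x / alpha
            * coef 1 (fun eps : C =>
                hypergeometrization (C_derive f) (1 + eps) (2 + eps) (power L alpha x)))
       x
       (1 / x * taylor_sum f (power L alpha x))) /\
  (* real variable, on the open interval (a, b) of (0, +oo) *)
  (forall (a b : Rbar) (L : R -> C),
     Rbar_le 0 a ->
     ln_branch_R (fun x : R => Rbar_lt a x /\ Rbar_lt x b) L ->
     (forall x : R, Rbar_lt a x /\ Rbar_lt x b ->
        Rbar_lt (Cmod (power L alpha x)) R0) ->
     forall x : R, Rbar_lt a x /\ Rbar_lt x b ->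
     is_RC_derive
       (fun x : R =>
          f 0 * L x
          + (taylor_sum f (power L alpha x) - f 0) / alpha
          - power L alpha x / alpha
            * coef 1 (fun eps : C =>
                hypergeometrization (C_derive f) (1 + eps) (2 + eps) (power L alpha x)))
       x
       (1 / RtoC x * taylor_sum f (power L alpha x))).
Proof.
  intros f R0 alpha _ -> _ Ha. split; [|split].
  - intros w Hw. split.
    + apply locally_Cmod. exists (mkposreal (1 / 4) ltac:(lra)). simpl. intros e He.
      exists (hypergeometrization (C_derive f) (1 + e) (2 + e) w).
      apply abs_summable_is_Cseries, hyper_term_summable; [exact Hw|].
      replace e with (e - 0) by ring. exact He.
    + apply locally_Cmod. exists (mkposreal (1 / 4) ltac:(lra)). simpl. intros e He.
      eexists. apply is_C_derive_hypergeometrization; [exact Hw|].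
      replace e with (e - 0) by ring. exact He.
  - intros U L HU _ _ HL Hin x Hx. apply is_C_derive_along.
    assert (HUx : @locally C_UniformSpace x U) by now apply HU.
    apply (antiderivative_along (@locally C_UniformSpace x) (fun y => y));
      [exact Ha | apply filterlim_id | now apply HL | now apply HL | | now apply Hin | ].
    + revert HUx. apply filter_imp. intros y Hy. now apply HL.
    + revert HUx. apply filter_imp. exact Hin.
  - intros a b L _ HL Hin x Hx. apply is_RC_derive_along.
    assert (HIx : locally x (fun y : R => Rbar_lt a y /\ Rbar_lt y b)).
    { apply filter_and; [apply (open_Rbar_gt a x) | apply (open_Rbar_lt b x)]; apply Hx. }
    apply (antiderivative_along (locally x) RtoC);
      [exact Ha | | now apply HL | now apply HL | | now apply Hin | ].
    + apply (filterlim_Cmod (locally x)). intros eps. exists eps. intros y Hy.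
      rewrite <- RtoC_minus, Cmod_R. exact Hy.
    + revert HIx. apply filter_imp. intros y Hy. now apply HL.
    + revert HIx. apply filter_imp. exact Hin.
Qed.
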